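(* For every $n>0$, the $F$-triangle $F_n(x,y)$ and the $H$-triangle $H_n(x,y)$ associated with the Hochschild lattice $\mathrm{Hoch}(n)$ are given by $$F_n(x,y)=(x+y+1)^{n-2}\Bigl(nx^2+2xy+(n+1)x+(y+1)^2\Bigr),$$ $$H_n(x,y)=(xy+1)^{n-2}\Bigl((xy+1)^2+(n-1)x\Bigr),$$ as identities of rational functions in $x,y$.
   Context: Hochschild lattice. For $n\geq 1$, a triword of length $n$ is a tuple $u=(u_1,\ldots,u_n)$ such that (T1) $u_i\in\{0,1,2\}$ for all $i$; (T2) $u_1\neq 2$; (T3) if $u_i=0$, then $u_j\neq 1$ for all $j>i$. Let $\mathrm{Tri}(n)$ be the set of all triwords of length $n$. The Hochschild lattice is $\mathrm{Hoch}(n)=(\mathrm{Tri}(n),\leq)$ where $\leq$ is the componentwise order. It is known to be a semidistributive lattice: the join is the componentwise maximum, and the meet is obtained by taking the componentwise minimum and then replacing by $0$ every entry $1$ that has an entry $0$ somewhere to its left. Core label order. Let $L$ be a finite semidistributive lattice. For a cover relation $a\lessdot b$ put $\lambda(a,b)=\min\{c\in L\mid a\vee c=b\}$; this minimum exists and is join irreducible. The nucleus of $a\in L$ is $a_\downarrow=a\wedge\bigwedge_{b\lessdot a}b$. The core label set of $a$ is $\Psi(a)=\{\lambda(b,b')\mid a_\downarrow\leq b\lessdot b'\leq a\}$. The map $a\mapsto\Psi(a)$ is injective. The core label order $\mathrm{CLO}(L)$ is the poset $(L,\sqsubseteq)$ where $a\sqsubseteq b$ if and only if $\Psi(a)\subseteq\Psi(b)$.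 Triangles. The poset $\mathrm{CLO}(\mathrm{Hoch}(n))$ is graded with least element $(0,\ldots,0)$; let $\mathrm{rk}$ be its rank function (so $\mathrm{rk}(0,\ldots,0)=0$) and $\mu_n$ its Möbius function (with $\mu_n(u,v)=0$ if $u\not\sqsubseteq v$). Define $$M_n(x,y)=\sum_{u,v\in\mathrm{Tri}(n)}\mu_n(u,v)\,x^{\mathrm{rk}(u)}y^{\mathrm{rk}(v)},$$ $$F_n(x,y)=y^n M_n\left(\frac{y+1}{y-x},\frac{y-x}{y}\right),\qquad H_n(x,y)=\bigl(x(y-1)+1\bigr)^n M_n\left(\frac{y}{y-1},\frac{x(y-1)}{x(y-1)+1}\right).$$ *)

(* Defs.v *)
From HB Require Import structures.
From mathcomp Require Import all_boot all_order all_algebra.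
From mathcomp Require Import mpoly fraction.

Set Implicit Arguments.
Unset Strict Implicit.
Unset Printing Implicit Defensive.

Import Order.TTheory GRing.Theory Num.Theory.

Local Open Scope order_scope.

Section FinitePoset.
Context {d : Order.disp_t} {P : finPOrderType d}.
Implicit Types u v w : P.

Definition covers u v := (u < v) && [forall w, ~~ (u < w < v)].

Definition is_chain (C : {set P}) := [forall x in C, forall y in C, x >=< y].

(* The largest number of elements of a chain strictly below [u]. When the poset
   is graded and has a least element this is its rank function; see
   [rank_unique]. *)
Definition rank u : nat :=
  \max_(C : {set P} | is_chain C && (C \subset [set w | w < u])) #|C|.

(* The recursion descends along strict chains, so [k := #|P|] is enough for it
   never to run out; the usual recursive equation is [mobiusE]. *)
Fixpoint mobius_rec (k : nat) u v : int :=
  if k is k'.+1 then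
    if u == v then 1%R
    else if u < v then (- \sum_(w | (u <= w < v)%O) mobius_rec k' u w)%R
    else 0%R
  else 0%R.

Definition mobius u v : int := mobius_rec #|P| u v.

Lemma mobius_recE k u v : (#|[set w | (u <= w < v)%O]| < k)%N ->
  mobius_rec k u v = mobius u v.
Proof.
have key : forall k1 k2 v, (#|[set w | (u <= w < v)%O]| < k1)%N ->
    (#|[set w | (u <= w < v)%O]| < k2)%N -> mobius_rec k1 u v = mobius_rec k2 u v.
  elim=> [|k1 IH] [|k2] {}v //= h1 h2.
  case: eqP => // _; case: ifP => // uv; congr (- _)%R.
  apply: eq_bigr => w /andP[uw wv].
  have lt_w : (#|[set z | (u <= z < w)%O]| < #|[set z | (u <= z < v)%O]|)%N.
    apply: proper_card; apply/properP; split.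
      apply/subsetP => z; rewrite !inE => /andP[-> zw] /=.
      exact: lt_trans zw wv.
    by exists w; rewrite !inE ?uw ?wv ?ltxx ?andbF.
  by apply: IH; apply: (leq_trans lt_w); rewrite -ltnS.
move=> hk; apply: key => //.
rewrite -cardsT; apply: proper_card; rewrite properT.
by apply/eqP => /setP/(_ v); rewrite !inE ltxx andbF.
Qed.

Lemma mobiusE u v :
  mobius u v = (if u == v then 1
                else if (u < v)%O then - \sum_(w | (u <= w < v)%O) mobius u w
                else 0)%R.
Proof.
rewrite -(@mobius_recE #|[set w | (u <= w < v)%O]|.+1) //=.
case: eqP => // _; case: ifP => // uv; congr (- _)%R.
apply: eq_bigr => w /andP[uw wv]; apply: mobius_recE.
apply: proper_card; apply/properP; split.
  apply/subsetP => z; rewrite !inE => /andP[-> zw] /=.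
  exact: lt_trans zw wv.
by exists w; rewrite !inE ?uw ?wv ?ltxx ?andbF.
Qed.

Lemma lt_covers u v : u < v -> exists2 w, u <= w & covers w v.
Proof.
move=> uv; pose A := [pred w | u <= w < v].
have Au : A u by rewrite /A /= lexx uv.
pose w := [arg max_(w > u | A w) #|[set z | (z <= w)%O]|]%N.
have [Aw maxw] : A w /\ forall z, A z -> (#|[set t | (t <= z)%O]| <= #|[set t | (t <= w)%O]|)%N.
  by rewrite /w; case: arg_maxnP.
case/andP: Aw => uw wv; exists w => //; rewrite /covers wv /=.
apply/forallP => z; apply/negP => /andP[wz zv].
have /maxw : A z by rewrite /A /= zv (le_trans uw (ltW wz)).
rewrite leqNgt => /negP; apply; apply: proper_card; apply/properP; split.
  by apply/subsetP => t; rewrite !inE => /le_trans; apply; apply: ltW.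
by exists z; rewrite inE // lt_geF.
Qed.

Lemma rank_unique (bot : P) (r : P -> nat) :
    (forall u, bot <= u) -> r bot = 0%N ->
    (forall u v, covers u v -> r v = (r u).+1) ->
  r =1 rank.
Proof.
move=> bot_le r_bot r_cov.
have r_lt : forall k u v, (#|[set z | (z <= v)%O]| <= k)%N -> u < v -> (r u < r v)%N.
  elim=> [|k IH] u v.
    by rewrite leqn0 => /eqP/cards0_eq/setP/(_ v); rewrite !inE lexx.
  move=> hk uv; have [w uw wv] := lt_covers uv.
  rewrite (r_cov _ _ wv) ltnS.
  move: uw; rewrite le_eqVlt => /orP[/eqP->//|uw]; apply: ltnW.
  apply: IH => //; rewrite -ltnS; apply: leq_trans hk; apply: proper_card.
  have wltv : w < v by case/andP: wv.
  apply/properP; split.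
    by apply/subsetP => z; rewrite !inE => zw; apply: ltW; apply: le_lt_trans wltv.
  by exists v; rewrite inE // lt_geF.
have {}r_lt u v : u < v -> (r u < r v)%N by apply: r_lt (leqnn _).
move=> u; apply/eqP; rewrite eqn_leq; apply/andP; split.
  suff [C hC <-] : exists2 C : {set P},
      is_chain C && (C \subset [set w | w < u]) & #|C| = r u.
    by rewrite /rank; apply: (@leq_bigmax_cond _ _ (fun C : {set P} => #|C|)).
  elim: {u}(r u) {-2}u (erefl (r u)) => [|k IH] u ru.
    exists set0; last by rewrite cards0.
    rewrite sub0set andbT.
    by apply/forall_inP => x; rewrite inE.
  have : bot < u.
    by rewrite lt_neqAle bot_le andbT; apply/eqP => bu; rewrite -bu r_bot in ru.
  case/lt_covers => w _ wu.
  have rw : r w = k by move: (r_cov _ _ wu); rewrite ru => -[].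
  have [C /andP[/forall_inP chC /subsetP subC] cC] := IH w rw.
  have wltu : w < u by case/andP: wu.
  have wC : w \notin C by apply/negP => /subC; rewrite inE ltxx.
  exists (w |: C); last by rewrite cardsU1 wC cC rw ru.
  apply/andP; split.
    apply/forall_inP => x; rewrite !inE => /orP[/eqP->|xC].
      apply/forall_inP => y; rewrite !inE => /orP[/eqP->|/subC].
        exact: comparablexx.
      by rewrite inE => /ltW yw; rewrite /Order.comparable yw orbT.
    apply/forall_inP => y; rewrite !inE => /orP[/eqP->|yC].
      by move/subC: xC; rewrite inE => /ltW xw; rewrite /Order.comparable xw.
    by move/forall_inP: (chC _ xC); apply.
  apply/subsetP => x; rewrite !inE => /orP[/eqP->//|/subC].
  by rewrite inE => /lt_trans; apply.
apply/bigmax_leqP => C /andP[/forall_inP chC /subsetP subC].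
have injr : {in C &, injective r}.
  move=> x y xC yC rxy; apply/eqP; case/boolP: (x == y) => // nxy.
  move/forall_inP: (chC _ xC) => /(_ _ yC) /orP[] le.
    have /r_lt : x < y by rewrite lt_neqAle nxy.
    by rewrite rxy ltnn.
  have /r_lt : y < x by rewrite lt_neqAle eq_sym nxy.
  by rewrite rxy ltnn.
have szC : size (map r (enum C)) = #|C| by rewrite size_map -cardE.
rewrite -szC -[r u](size_iota 0); apply: uniq_leq_size.
  by rewrite map_inj_in_uniq ?enum_uniq // => x y; rewrite !mem_enum; apply: injr.
move=> k /mapP[x]; rewrite mem_enum => /subC; rewrite inE => /r_lt xu ->.
by rewrite mem_iota.
Qed.

End FinitePoset.

HB.mixin Record isSemidistributive (d : Order.disp_t) L
    of Order.FinTBLattice d L := {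
  join_semidistr : forall x y z : L,
    x `|` y = x `|` z -> x `|` y = x `|` (y `&` z);
  meet_semidistr : forall x y z : L,
    x `&` y = x `&` z -> x `&` y = x `&` (y `|` z)
}.

#[short(type="finSemidistrLatticeType")]
HB.structure Definition FinSemidistrLattice d :=
  { L of isSemidistributive d L & Order.FinTBLattice d L }.

Section CoreLabels.
Context {d : Order.disp_t} {L : finSemidistrLatticeType d}.
Implicit Types a b c : L.

Definition is_label a b c :=
  (a `|` c == b) && [forall c', (a `|` c' == b) ==> (c <= c')].

(* The default value is never used on a cover relation: see [labelP]. *)
Definition label a b : L := odflt \bot [pick c | is_label a b c].

Definition nucleus a : L := a `&` \meet_(b | covers b a) b.

Definition core_labels a : {set L} :=
  [set label p.1 p.2 | p : L * L
     & [&& nucleus a <= p.1, covers p.1 p.2 & p.2 <= a]].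

Lemma labelP a b : a <= b -> is_label a b (label a b).
Proof.
move=> ab; rewrite /label; case: pickP => //= noc.
pose m := \meet_(c | a `|` c == b) c.
suff am : a `|` m = b.
  move: (noc m); rewrite /is_label am eqxx /= => /negbT/negP; case.
  by apply/forallP => c; apply/implyP => hc; apply: meets_inf.
have : a `|` (b `&` m) = b.
  rewrite /m; apply: (big_rec (fun m => a `|` (b `&` m) = b)).
    by rewrite meetx1; apply: join_r.
  move=> c x /eqP hc hx; rewrite meetCA.
  by rewrite -[RHS]hc; apply/esym/join_semidistr; rewrite hx.
suff /meet_r -> : m <= b by [].
by apply: meets_inf; apply/eqP/join_r.
Qed.

Lemma join_core_labels a : \join_(c in core_labels a) c = a.
Proof.
set j := \join_(_ in _) _; have ja : j <= a.
  apply/joinsP => c /imsetP[[b b']] /[!inE] /= /and3P[_ /andP[bb' _] b'a] ->.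
  apply: le_trans b'a; have /andP[/eqP lab _] := labelP (ltW bb').
  by rewrite -[leRHS]lab leUr.
rewrite le_eqVlt in ja; case/orP: ja => [/eqP->//|/lt_covers[b jb ba]].
have blta : b < a by case/andP: ba.
have /andP[/eqP lab _] := labelP (ltW blta).
suff : a <= b by move=> /(lt_le_trans blta); rewrite ltxx.
rewrite -lab leUx lexx /=; apply: le_trans jb.
apply: (joins_min (j := label b a)) => //.
apply/imsetP; exists (b, a) => //; rewrite inE /= ba lexx !andbT.
by apply: le_trans (leIr _ _) _; apply: meets_inf.
Qed.

Lemma core_labels_inj : injective core_labels.
Proof. by move=> a b eab; rewrite -(join_core_labels a) eab join_core_labels. Qed.

End CoreLabels.

Definition clo {d} (L : finSemidistrLatticeType d) : Type := L.

Fact clo_display : Order.disp_t -> Order.disp_t. Proof. by []. Qed.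

Section CoreLabelOrder.
Context {d : Order.disp_t} {L : finSemidistrLatticeType d}.

HB.instance Definition _ := Finite.copy (clo L) L.

Definition core_le (a b : clo L) :=
  core_labels (a : L) \subset core_labels (b : L).

Fact core_le_refl : reflexive core_le.
Proof. by move=> a; apply: subxx. Qed.

Fact core_le_anti : antisymmetric core_le.
Proof. by move=> a b /= eab; apply: core_labels_inj; apply/eqP; rewrite eqEsubset. Qed.

Fact core_le_trans : transitive core_le.
Proof. by move=> b a c; apply: subset_trans. Qed.

HB.instance Definition _ := Order.Le_isPOrder.Build (clo_display d) (clo L)
  core_le_refl core_le_anti core_le_trans.

Lemma clo_bot_le (a : clo L) : ((\bot : L) : clo L) <= a.
Proof.
apply/subsetP => c /imsetP[[b b']] /[!inE] /= /and3P[_ /andP[bb' _]].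
by rewrite lex0 => /eqP b'0; move: bb'; rewrite b'0 ltx0.
Qed.

End CoreLabelOrder.

(* Entries are indexed from 0, so the first letter of [u] is its entry 0. *)
Definition is_triword n (u : {ffun 'I_n -> 'I_3}) : bool :=
  [forall i : 'I_n, (i == 0 :> nat) ==> (u i != 2 :> nat)] &&
  [forall i : 'I_n, forall j : 'I_n,
     (i < j)%N ==> (u i == 0 :> nat) ==> (u j != 1 :> nat)].

Record hoch (n : nat) := Triword {
  triword_val :> {ffun 'I_n -> 'I_3};
  _ : is_triword triword_val
}.

HB.instance Definition _ n := [isSub for @triword_val n].
HB.instance Definition _ n := [Finite of hoch n by <:].

Fact hoch_display : Order.disp_t. Proof. exact: Order.Disp tt tt. Qed.

Section Hochschild.
Variable n : nat.
Implicit Types (u v w : hoch n) (f g p q : {ffun 'I_n -> 'I_3}) (i j k : 'I_n).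

Lemma triwordP (f : {ffun 'I_n -> 'I_3}) :
  reflect ((forall i : 'I_n, i = 0 :> nat -> f i <> 2 :> nat) /\
           (forall i j : 'I_n, (i < j)%N -> f i = 0 :> nat -> f j <> 1 :> nat))
          (is_triword f).
Proof.
apply: (iffP andP) => -[h1 h2]; split.
- by move=> i i0; apply/eqP; move/forallP/(_ i)/implyP: h1; apply; apply/eqP.
- move=> i j ij ui0; apply/eqP; move/forallP/(_ i)/forallP/(_ j): h2.
  by rewrite ij ui0.
- by apply/forallP => i; apply/implyP => /eqP i0; apply/eqP; apply: h1.
- apply/forallP => i; apply/forallP => j; apply/implyP => ij.
  by apply/implyP => /eqP ui0; apply/eqP; apply: h2 ij _.
Qed.

Lemma hochP u :
  (forall i : 'I_n, i = 0 :> nat -> u i <> 2 :> nat) /\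
  (forall i j : 'I_n, (i < j)%N -> u i = 0 :> nat -> u j <> 1 :> nat).
Proof. by apply/triwordP; case: u. Qed.

Lemma hoch_inj u v : (forall i, u i = v i :> nat) -> u = v.
Proof. by move=> uv; apply/val_inj/ffunP => i; apply/val_inj/uv. Qed.

Definition hoch_le u v := [forall i, (u i <= v i)%N].

Definition join_fun (f g : {ffun 'I_n -> 'I_3}) : {ffun 'I_n -> 'I_3} :=
  [ffun i => if (f i <= g i)%N then g i else f i].

Definition min_fun (f g : {ffun 'I_n -> 'I_3}) : {ffun 'I_n -> 'I_3} :=
  [ffun i => if (f i <= g i)%N then f i else g i].

Definition fix_fun (f : {ffun 'I_n -> 'I_3}) : {ffun 'I_n -> 'I_3} :=
  [ffun i => if (f i == 1 :> nat) && [exists j : 'I_n, (j < i)%N && (f j == 0 :> nat)]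
             then ord0 else f i].

Definition meet_fun f g := fix_fun (min_fun f g).

Lemma join_funE f g i : join_fun f g i = maxn (f i) (g i) :> nat.
Proof. by rewrite ffunE; case: leqP. Qed.

Lemma min_funE f g i : min_fun f g i = minn (f i) (g i) :> nat.
Proof. by rewrite ffunE; case: leqP. Qed.

Lemma fix_fun_le f i : (fix_fun f i <= f i)%N.
Proof. by rewrite ffunE; case: ifP. Qed.

Lemma fix_fun_id f i : f i != 1 :> nat -> fix_fun f i = f i.
Proof. by rewrite ffunE => /negbTE->. Qed.

Lemma fix_fun0 f i : f i = 0 :> nat -> fix_fun f i = 0 :> nat.
Proof. by move=> fi; rewrite fix_fun_id ?fi. Qed.

Lemma fix_fun0_below f (i j : 'I_n) :
  (j < i)%N -> f j = 0 :> nat -> f i = 1 :> nat -> fix_fun f i = 0 :> nat.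
Proof.
move=> ji fj fi; rewrite ffunE fi eqxx /=; case: existsP => //= -[].
by exists j; rewrite ji fj.
Qed.

Lemma fix_fun_pos f i : (forall j : 'I_n, (j < i)%N -> f j <> 0 :> nat) ->
  fix_fun f i = f i.
Proof.
move=> h; rewrite ffunE; case: ifP => // /andP[_ /existsP[j /andP[ji /eqP fj]]].
by case: (h j ji).
Qed.

Lemma fix_fun_eq0 f i : fix_fun f i = 0 :> nat -> f i = 0 :> nat \/
  f i = 1 :> nat /\ exists2 j : 'I_n, (j < i)%N & f j = 0 :> nat.
Proof.
rewrite ffunE; case: ifP => [/andP[/eqP fi /existsP[j /andP[ji /eqP fj]]] _|_ ->].
  by right; split=> //; exists j.
by left.
Qed.

Lemma join_triword u v : is_triword (join_fun u v).
Proof.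
have [[u1 u2] [v1 v2]] := (hochP u, hochP v).
apply/triwordP; split=> [i i0|i j ij].
  by rewrite ffunE; case: ifP => _; [apply: v1|apply: u1].
rewrite !join_funE => /eqP; rewrite -leqn0 geq_max !leqn0 => /andP[/eqP ui /eqP vi].
rewrite /maxn; case: ifP => _; [exact: v2 ij vi|exact: u2 ij ui].
Qed.

Lemma meet_triword u v : is_triword (meet_fun u v).
Proof.
have [[u1 u2] [v1 v2]] := (hochP u, hochP v).
apply/triwordP; split=> [i i0|i j ij].
  rewrite ffunE; case: ifP => // _.
  by rewrite ffunE; case: ifP => _; [apply: u1|apply: v1].
move=> mi mj.
have fj : min_fun u v j = 1 :> nat.
  by move: mj; rewrite ffunE; case: ifP.
have [fi|[_ [k ki fk]]] := fix_fun_eq0 mi.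
  by move: mj; rewrite (fix_fun0_below ij fi fj).
by move: mj; rewrite (fix_fun0_below (ltn_trans ki ij) fk fj).
Qed.

Definition hoch_join u v : hoch n := Triword (join_triword u v).
Definition hoch_meet u v : hoch n := Triword (meet_triword u v).

Fact hoch_le_refl : reflexive hoch_le.
Proof. by move=> u; apply/forallP. Qed.

Fact hoch_le_anti : antisymmetric hoch_le.
Proof.
move=> u v /andP[/forallP uv /forallP vu]; apply: hoch_inj => i.
by apply/eqP; rewrite eqn_leq uv vu.
Qed.

Fact hoch_le_trans : transitive hoch_le.
Proof.
move=> v u w /forallP uv /forallP vw; apply/forallP => i.
exact: leq_trans (uv i) (vw i).
Qed.

HB.instance Definition _ := Order.Le_isPOrder.Build hoch_display (hoch n)
  hoch_le_refl hoch_le_anti hoch_le_trans.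

Lemma leEhoch u v : (u <= v) = [forall i, (u i <= v i)%N].
Proof. by []. Qed.

Fact hoch_meetP u v w : (u <= hoch_meet v w) = (u <= v) && (u <= w).
Proof.
rewrite !leEhoch; apply/forallP/andP => [uvw|[/forallP uv /forallP uw] i].
  split; apply/forallP => i; apply: (leq_trans (uvw i));
    apply: (leq_trans (fix_fun_le _ _)); rewrite min_funE.
    exact: geq_minl.
  exact: geq_minr.
have min_ge k : (u k <= min_fun v w k)%N by rewrite min_funE leq_min uv uw.
rewrite /= /meet_fun ffunE; case: ifP => // /andP[/eqP mi /existsP[j /andP[ji /eqP mj]]].
have := min_ge j; rewrite mj leqn0 => /eqP uj.
have := min_ge i; rewrite mi.
have := (hochP u).2 j i ji uj; rewrite /= leqn0.
by case: (nat_of_ord (u i)) => [|[|]].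
Qed.

Fact hoch_joinP u v w : (hoch_join u v <= w) = (u <= w) && (v <= w).
Proof.
rewrite !leEhoch; apply/forallP/andP => [uvw|[/forallP uw /forallP vw] i].
  split; apply/forallP => i; have := uvw i; rewrite join_funE geq_max;
    by case/andP.
by rewrite join_funE geq_max uw vw.
Qed.

HB.instance Definition _ :=
  Order.POrder_MeetJoin_isLattice.Build hoch_display (hoch n)
    hoch_meetP hoch_joinP.

Fact bot_triword : is_triword ([ffun => ord0] : {ffun 'I_n -> 'I_3}).
Proof. by apply/triwordP; split=> [i _|i j _ _]; rewrite ffunE. Qed.

Definition hoch_bot : hoch n := Triword bot_triword.

Fact hoch_le0x u : hoch_bot <= u.
Proof. by apply/forallP => i; rewrite ffunE. Qed.

HB.instance Definition _ := Order.hasBottom.Build hoch_display (hoch n) hoch_le0x.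

Definition top_fun : {ffun 'I_n -> 'I_3} :=
  [ffun i : 'I_n => if i == 0 :> nat then inord 1 else ord_max].

Fact top_triword : is_triword top_fun.
Proof.
by apply/triwordP; split=> [i i0|i j ij]; rewrite ffunE ?i0 /=;
  [rewrite inordK | case: ifP; rewrite ?inordK].
Qed.

Definition hoch_top : hoch n := Triword top_triword.

Fact hoch_lex1 u : u <= hoch_top.
Proof.
apply/forallP => i; rewrite ffunE; case: eqP => [i0|_].
  have := (hochP u).1 i i0; rewrite inordK //=.
  by case: (u i) => -[|[|[|]]].
by rewrite -ltnS ltn_ord.
Qed.

HB.instance Definition _ := Order.hasTop.Build hoch_display (hoch n) hoch_lex1.

Lemma joinEhoch u v i : (u `|` v) i = maxn (u i) (v i) :> nat.
Proof. exact: join_funE. Qed.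

(* The value of a meet, as in the usual description: the componentwise minimum,
   in which every 1 with a 0 to its left has been replaced by 0. *)
Lemma meetEhoch u v i :
  (u `&` v) i = (if (minn (u i) (v i) == 1) &&
                   [exists j : 'I_n, (j < i)%N && (minn (u j) (v j) == 0)]
                then 0 else minn (u i) (v i)) :> nat.
Proof.
have -> : [exists j : 'I_n, (j < i)%N && (minn (u j) (v j) == 0)] =
    [exists j : 'I_n, (j < i)%N && (min_fun u v j == 0 :> nat)].
  by apply: eq_existsb => j; rewrite min_funE.
by rewrite -min_funE [LHS]/= /meet_fun ffunE; case: ifP.
Qed.

Fact hoch_join_semidistr u v w :
  u `|` v = u `|` w -> u `|` v = u `|` (v `&` w).
Proof.
move=> e; apply: hoch_inj => i; rewrite !joinEhoch meetEhoch.
have ek k : maxn (u k) (v k) = maxn (u k) (w k) by rewrite -!joinEhoch e.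
case: ifP => [/andP[/eqP mi /existsP[j /andP[ji /eqP mj]]]|_]; last first.
  by rewrite maxn_minr -ek minnn.
have hv := (hochP v).2 j i ji; have hw := (hochP w).2 j i ji.
move: (ek i) mi mj hv hw => /=.
case: (u i) (v i) (w i) (v j) (w j) =>
  [[|[|[|//]]] ?] [[|[|[|//]]] ?] [[|[|[|//]]] ?] [[|[|[|//]]] ?] [[|[|[|//]]] ?] //=;
  rewrite ?maxnE ?minnE //= => _ _ _ hv hw; first [by case: hv | by case: hw].
Qed.

Lemma fix_fun_max (p q : {ffun 'I_n -> 'I_3}) : fix_fun p = fix_fun q ->
  forall i, fix_fun (join_fun p q) i = fix_fun p i :> nat.
Proof.
move=> e i.
have ek k : fix_fun p k = fix_fun q k :> nat by rewrite e.
have zero (k : 'I_n) : (forall j : 'I_n, (j < k)%N -> join_fun p q j <> 0 :> nat) ->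
    forall j : 'I_n, (j < k)%N -> p j <> 0 :> nat /\ q j <> 0 :> nat.
  move=> h j; elim/ltn_ind: {j}(nat_of_ord j) {-2}j (erefl (nat_of_ord j)) => m IH j jm jk.
  have hj := h j jk; rewrite /= join_funE in hj.
  have below : forall l : 'I_n, (l < j)%N -> p l <> 0 :> nat /\ q l <> 0 :> nat.
    by move=> l lj; apply: (IH l) => //; rewrite -?jm //; apply: ltn_trans lj jk.
  have := ek j; rewrite !fix_fun_pos; try by move=> l /below[].
  by move=> /= epq; move: hj; rewrite epq maxnn.
have [ex|nex] := boolP [exists j : 'I_n, (j < i)%N && (join_fun p q j == 0 :> nat)].
  case/existsP: ex => j /andP[ji /eqP rj].
  have [pj qj] : p j = 0 :> nat /\ q j = 0 :> nat.
    move: rj; rewrite /= join_funE => /eqP; rewrite -leqn0 geq_max !leqn0.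
    by case/andP => /eqP-> /eqP->.
  have red f : f j = 0 :> nat -> fix_fun f i = (if f i == 2 :> nat then 2 else 0) :> nat.
    move=> fj; case: (altP (nat_of_ord (f i) =P 1)) => fi.
      by rewrite fi (fix_fun0_below ji fj fi).
    rewrite fix_fun_id //; move: fi => /=.
    by case: (f i) => -[|[|[|]]].
  have := ek i; rewrite !red // join_funE /=.
  case: (p i) (q i) => [[|[|[|//]]] ?] [[|[|[|//]]] ?] //=.
have h (j : 'I_n) : (j < i)%N -> join_fun p q j <> 0 :> nat.
  move=> ji rj; move/existsP: nex; case; exists j; by rewrite ji rj.
have pq := zero i h.
have := ek i; rewrite !fix_fun_pos //; try by move=> j /pq[].
by move=> /= epq; rewrite join_funE -epq maxnn.
Qed.

Fact hoch_meet_semidistr u v w :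
  u `&` v = u `&` w -> u `&` v = u `&` (v `|` w).
Proof.
move=> e; apply: hoch_inj => i.
have e' : fix_fun (min_fun u v) = fix_fun (min_fun u w) by case: e.
rewrite /= /meet_fun.
suff -> : min_fun u (join_fun v w) = join_fun (min_fun u v) (min_fun u w).
  by rewrite /= fix_fun_max.
by apply/ffunP => k; apply/val_inj; rewrite /= !(min_funE, join_funE) minn_maxr.
Qed.

HB.instance Definition _ := isSemidistributive.Build hoch_display (hoch n)
  hoch_join_semidistr hoch_meet_semidistr.

End Hochschild.

Local Open Scope ring_scope.

Section Triangles.
Variable K : fieldType.

Definition M_triangle n (x y : K) : K :=
  \sum_(u : clo (hoch n)) \sum_(v : clo (hoch n))
    (mobius u v)%:~R * x ^+ rank u * y ^+ rank v.

Definition F_triangle n (x y : K) : K :=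
  y ^+ n * M_triangle n ((y + 1) / (y - x)) ((y - x) / y).

Definition H_triangle n (x y : K) : K :=
  (x * (y - 1) + 1) ^+ n *
  M_triangle n (y / (y - 1)) (x * (y - 1) / (x * (y - 1) + 1)).

End Triangles.

(* The field Q(x, y) of rational functions and its two indeterminates. *)
Definition ratfun2 : fieldType := {fraction {mpoly rat[2]}}.
Definition ratX : ratfun2 := tofrac 'X_(@ord0 1).
Definition ratY : ratfun2 := tofrac 'X_(@ord_max 1).

(* Main.v *)
(* The join irreducibles of Hoch(n) are the words 0..020..0 and 1..10..0. The core
   labels of u of the first kind are given by the positions of its 2's, those of
   the second kind by the positions from its last 1 to its first 0 (none if u
   starts with 0). Hence u [= v means inclusion of both position sets, and the
   rank of u is its number b of 2's, plus 1 if u starts with 1. If u starts with 1,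
   each set of 2's containing that of u is realised by exactly one v above u; if u
   starts with 0, every v whose 2's contain those of u lies above u. With N = n - 1,
   this makes the weights d(u) = y^b (1 - y)^(N - b) c, where c = y if u starts with
   1 and c = 1 - (n - b) y otherwise, sum over the up-set of u to y^(rk u). By
   Moebius inversion M_n is the sum of the x^(rk u) d(u), which is
   s^n + (x - 1) y N (1 - y) s^(n - 2) for s = 1 - y + x y. *)
Require Import Defs.
From mathcomp Require Import all_boot all_order all_algebra.
From mathcomp Require Import ring mpoly fraction.
Set Implicit Arguments.
Unset Strict Implicit.
Unset Printing Implicit Defensive.
Import Order.TTheory GRing.Theory.
Local Open Scope order_scope.

(** * Labels and nuclei in a finite semidistributive lattice *)

Section Labels.
Context {d : Order.disp_t} {L : finSemidistrLatticeType d}.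
Implicit Types a b c : L.

Lemma label_eq a b c : a <= b -> is_label a b c -> label a b = c.
Proof.
move=> ab /andP[ac /forallP minc].
have /andP[al /forallP minl] := labelP ab.
by apply: le_anti; rewrite (implyP (minl _) ac) (implyP (minc _) al).
Qed.

Lemma covers_join a b c : covers a b -> c <= b -> ~~ (c <= a) -> a `|` c = b.
Proof.
move=> /andP[ab /forallP/(_ (a `|` c))]; rewrite negb_and => h cb ca.
have acb : a `|` c <= b by rewrite leUx (ltW ab).
have aac : a < a `|` c.
  by rewrite lt_neqAle leUl andbT; apply: contra ca => /eqP ->; apply: leUr.
by move: h; rewrite aac /= lt_neqAle acb andbT negbK => /eqP.
Qed.

Lemma label_min a b c : covers a b -> c <= b -> ~~ (c <= a) ->
  (forall c', a `|` c' = b -> c <= c') -> label a b = c.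
Proof.
move=> ab cb ca minc; have /andP[/ltW leab _] := ab.
apply: label_eq => //; rewrite /is_label (covers_join ab) // eqxx /=.
by apply/forallP => c'; apply/implyP => /eqP /minc.
Qed.

Lemma nucleus_le a : nucleus a <= a.
Proof. exact: leIl. Qed.

Lemma nucleus_covers a b : covers b a -> nucleus a <= b.
Proof. by move=> ba; apply: le_trans (leIr _ _) _; apply: meets_inf. Qed.

Lemma core_labels_le a c : c \in core_labels a -> c <= a.
Proof. by move=> ca; rewrite -(join_core_labels a); apply: joins_sup. Qed.

End Labels.

(** * Core labels of triwords *)

Section CoreLabelsHoch.
Variable m : nat.
Implicit Types (u v w : hoch m.+1) (D : {set 'I_m}) (i j : 'I_m.+1) (k : nat).

Lemma hoch_leP u v : reflect (forall i, (u i <= v i)%N) (u <= v).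
Proof. exact: forallP. Qed.

Lemma hoch0 u : (u ord0 < 2)%N.
Proof. by have := (hochP u).1 ord0 erefl; case: (u ord0) => [[|[|[]]]]. Qed.

Lemma hoch_le2 u i : (u i <= 2)%N.
Proof. by rewrite -ltnS ltn_ord. Qed.

Lemma hoch_zero u (i j : 'I_m.+1) : (i <= j)%N -> u i = 0 :> nat -> u j != 1 :> nat.
Proof.
rewrite leq_eqVlt => /orP[/eqP/val_inj <- -> //|ij ui].
exact/eqP/(hochP u).2/ui.
Qed.

(** The first letter is never 2, so [D] indexes the remaining positions and is shifted by
    [lift ord0]. The join irreducibles arise as [D = [set l]], [k = 0] and as [D = set0],
    [k = i.+1]; every triword has this form with [D] its set of 2's. *)
Definition hoch_of_fun D k : {ffun 'I_m.+1 -> 'I_3} :=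
  [ffun i : 'I_m.+1 => if i \in lift ord0 @: D then ord_max
    else if (i < k)%N then inord 1 else ord0].

Lemma hoch_of_funE D k (i : 'I_m.+1) : hoch_of_fun D k i =
  (if i \in lift ord0 @: D then 2 else if (i < k)%N then 1 else 0)%N :> nat.
Proof. by rewrite ffunE; do 2?case: ifP => // _; rewrite inordK. Qed.

Fact hoch_of_triword D k : is_triword (hoch_of_fun D k).
Proof.
apply/triwordP; split=> [i i0|i j ij]; rewrite !hoch_of_funE.
  have -> : (i \in lift ord0 @: D) = false.
    by apply/negP => /imsetP[l _ il]; move: i0; rewrite il.
  by case: ifP.
case: ifP => // _; case: ltnP => // ki _.
by case: ifP => // _; rewrite ltnNge (leq_trans ki (ltnW ij)).
Qed.

Definition hoch_of D k : hoch m.+1 := Triword (hoch_of_triword D k).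

Lemma hoch_ofE D k (i : 'I_m.+1) : hoch_of D k i =
  (if i \in lift ord0 @: D then 2 else if (i < k)%N then 1 else 0)%N :> nat.
Proof. exact: hoch_of_funE. Qed.

Definition twos u : {set 'I_m} := [set l | u (lift ord0 l) == 2 :> nat].

(* The positions from the last 1 (included) to the first 0 (excluded); empty
   when [u] has no 1. *)
Definition run u : {set 'I_m.+1} :=
  [set i : 'I_m.+1 | [forall j : 'I_m.+1,
    if (j <= i)%N then u j != 0 :> nat else u j != 1 :> nat]].

Lemma mem_lift_twos u (i : 'I_m.+1) : (i \in lift ord0 @: twos u) = (u i == 2 :> nat).
Proof.
case: (unliftP ord0 i) => [l|] ->.
  by rewrite mem_imset ?inE //; apply: lift_inj.
have := hoch0 u; rewrite ltn_neqAle => /andP[/negbTE -> _].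
by apply/imsetP => -[l _ /eqP]; rewrite (negbTE (neq_lift _ _)).
Qed.

Lemma runP u (i : 'I_m.+1) : reflect
  ((forall j : 'I_m.+1, (j <= i)%N -> u j != 0 :> nat) /\
  (forall j : 'I_m.+1, (i < j)%N -> u j != 1 :> nat)) (i \in run u).
Proof.
rewrite inE; apply: (iffP forallP) => [h|[h1 h2] j]; last first.
  by case: leqP => [/h1|/h2].
by split=> j; have := h j; case: leqP.
Qed.

Lemma le_two l u : (hoch_of [set l] 0 <= u) = (u (lift ord0 l) == 2 :> nat).
Proof.
have lE i : (i \in lift ord0 @: [set l]) = (i == lift ord0 l).
  by rewrite imset_set1 inE.
apply/hoch_leP/eqP => [/(_ (lift ord0 l))|ul i].
  rewrite hoch_ofE lE eqxx => h; apply/eqP; rewrite eqn_leq h andbT.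
  exact: hoch_le2.
by rewrite hoch_ofE lE; case: eqP => [->|//]; rewrite ul.
Qed.

Lemma le_one i u :
  reflect (forall j : 'I_m.+1, (j <= i)%N -> u j != 0 :> nat) (hoch_of set0 i.+1 <= u).
Proof.
apply: (iffP (hoch_leP _ _)) => h j.
  by move=> ji; have := h j; rewrite hoch_ofE imset0 inE ltnS ji lt0n.
by rewrite hoch_ofE imset0 inE ltnS; case: ifP => // /h; rewrite lt0n.
Qed.

Lemma le_one1 i u : u i = 1 :> nat -> hoch_of set0 i.+1 <= u.
Proof.
move=> ui; apply/le_one => j ji; apply/negP => /eqP uj.
by have := hoch_zero ji uj; rewrite ui.
Qed.

Lemma label_two u v l : covers u v -> u (lift ord0 l) != 2 :> nat ->
  v (lift ord0 l) = 2 :> nat -> label u v = hoch_of [set l] 0.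
Proof.
move=> uv ul vl; apply: label_min; rewrite ?le_two ?vl // => c ucv.
rewrite le_two; have /eqP := joinEhoch u c (lift ord0 l).
rewrite ucv vl /maxn; case: ifP => _; rewrite eq_sym //.
by rewrite (negbTE ul).
Qed.

Lemma label_one u v (i : 'I_m.+1) : covers u v -> u i = 0 :> nat -> v i = 1 :> nat ->
  label u v = hoch_of set0 i.+1.
Proof.
move=> uv ui vi; apply: label_min => //; first exact: le_one1.
  by apply/negP => /le_one /(_ i (leqnn i)); rewrite ui.
by move=> c ucv; apply: le_one1; have := joinEhoch u c i; rewrite ucv vi ui max0n.
Qed.

Lemma core_labels_cases u c : c \in core_labels u ->
  (exists l, c = hoch_of [set l] 0) \/ (exists i, c = hoch_of set0 i.+1).
Proof.
case/imsetP => -[v w] /[!inE] /= /and3P[_ vw _] ->.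
have /andP[ltvw _] := vw.
(* Some entry grows along the cover; whether its new value is 2 or 1 decides the kind of the
   label. *)
have [i vwi] : exists i, (v i < w i)%N.
  apply/existsP; apply: contraT; rewrite negb_exists => /forallP h.
  move: ltvw; rewrite lt_leAnge => /andP[_ /hoch_leP[]] i.
  by rewrite leqNgt.
have [wi|wi] := eqVneq (w i : nat) 2.
  left; case: (unliftP ord0 i) (wi) vwi => [l|] -> {}wi vi.
    by exists l; apply: label_two => //; move: vi; rewrite wi ltn_neqAle => /andP[].
  by have := hoch0 w; rewrite wi.
have {}wi : (w i < 2)%N by rewrite ltn_neqAle wi hoch_le2.
right; exists i; apply: label_one => //.
  by case: (v i : nat) vwi (leq_trans vwi wi) => [|[]].
by apply/eqP; rewrite eqn_leq -ltnS wi (leq_ltn_trans _ vwi).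
Qed.

(* Everything between [w] and [u] agrees with [u] outside [i], hence so does any
   element above [w] covered by [u]. *)
Lemma lower_covers u (i : 'I_m.+1) (w : hoch m.+1) : (w i < u i)%N ->
  (forall j, j != i -> w j = u j :> nat) ->
  exists2 v, covers v u & (v i < u i)%N.
Proof.
move=> wi wj; have wu : w < u.
  rewrite lt_leAnge; apply/andP; split.
    by apply/hoch_leP => j; have [->|/wj ->//] := eqVneq j i; apply: ltnW.
  by apply/negP => /hoch_leP /(_ i); rewrite leqNgt wi.
have [v wv vu] := lt_covers wu; exists v => //; rewrite ltnNge.
apply/negP => uv; have /andP[ltvu _] := vu.
move: ltvu; rewrite lt_leAnge => /andP[_ /negP[]]; apply/hoch_leP => j.
have [->//|/wj <-] := eqVneq j i; exact/(hoch_leP _ _ wv).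
Qed.

Lemma covers_two u (i : 'I_m.+1) : u i = 2 :> nat -> exists2 v, covers v u & (v i < 2)%N.
Proof.
(* The 2 is lowered to 1, or to 0 when a 0 to its left makes a 1 illegal by (T3). *)
move=> ui; pose f := [ffun j => if j == i then
  if [exists j : 'I_m.+1, (j < i)%N && (u j == 0 :> nat)] then ord0 else inord 1
  else u j] : {ffun 'I_m.+1 -> 'I_3}.
have fj j : j != i -> f j = u j :> nat by rewrite ffunE => /negbTE ->.
have fi : f i = ~~ [exists j : 'I_m.+1, (j < i)%N && (u j == 0 :> nat)] :> nat.
  by rewrite ffunE eqxx; case: ifP => //=; rewrite inordK.
have tf : is_triword f.
  apply/triwordP; split=> [j j0|j k jk].
    have [->|/fj ->] := eqVneq j i; last exact: (hochP u).1.
    by rewrite fi; case: (~~ _).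
  have [ji|/fj ->] := eqVneq j i; have [ki|/fj ->] := eqVneq k i.
  - by move: jk; rewrite ji ki ltnn.
  - rewrite ji fi; case: existsP => // -[l /andP[li /eqP ul]] _.
    apply: (hochP u).2 ul => //; apply: ltn_trans li _; by rewrite -ji.
  - rewrite ki fi => uj; case: existsP => // -[]; exists j.
    by rewrite -ki jk uj.
  exact: (hochP u).2.
have [|v vu] := @lower_covers u i (Triword tf) _ fj.
  by rewrite /= fi ui; case: (~~ _).
by rewrite ui; exists v.
Qed.

(** The last 1 can be turned into 0 without violating (T3), because no 1 follows it. *)
Lemma covers_last_one u (i : 'I_m.+1) : u i = 1 :> nat ->
  (forall j : 'I_m.+1, (i < j)%N -> u j != 1 :> nat) ->
  exists2 v, covers v u & v i = 0 :> nat.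
Proof.
move=> ui lasti.
pose f := [ffun j => if j == i then ord0 else u j] : {ffun 'I_m.+1 -> 'I_3}.
have fj j : j != i -> f j = u j :> nat by rewrite ffunE => /negbTE ->.
have fi : f i = 0 :> nat by rewrite ffunE eqxx.
have tf : is_triword f.
  apply/triwordP; split=> [j j0|j k jk].
    have [->|/fj ->] := eqVneq j i; last exact: (hochP u).1.
    by rewrite fi.
  have [ki|/fj ->] := eqVneq k i; first by rewrite ki fi.
  have [ji|/fj ->] := eqVneq j i; last exact: (hochP u).2.
  by move=> _; apply/eqP/lasti; rewrite -ji.
have [|v vu] := @lower_covers u i (Triword tf) _ fj; first by rewrite /= fi ui.
by rewrite ui ltnS leqn0 => /eqP; exists v.
Qed.

Lemma run_last_one u (i : 'I_m.+1) : u i = 1 :> nat ->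
  (forall j : 'I_m.+1, (i < j)%N -> u j != 1 :> nat) -> i \in run u.
Proof. by move=> ui lasti; apply/runP; split=> //; apply/le_one/le_one1. Qed.

Lemma exists_last_one u : u ord0 != 0 :> nat ->
  exists i, u i = 1 :> nat /\ forall j : 'I_m.+1, (i < j)%N -> u j != 1 :> nat.
Proof.
move=> u0; have {}u0 : u ord0 == 1 :> nat.
  by have := hoch0 u; case: (u ord0 : nat) u0 => [|[]].
case: (@arg_maxnP _ ord0 (fun i => u i == 1 :> nat) (@nat_of_ord _) u0) => i /eqP ui maxi.
by exists i; split=> // j; rewrite ltnNge; apply: contra => /maxi.
Qed.

Lemma nucleus_le1 u (i : 'I_m.+1) : (nucleus u i <= 1)%N.
Proof.
have [/covers_two[v /nucleus_covers/hoch_leP/(_ i) nv vi]|ui] := eqVneq (u i : nat) 2.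
  by rewrite -ltnS (leq_ltn_trans nv vi).
have /hoch_leP/(_ i) nu := nucleus_le u.
by apply: leq_trans nu _; rewrite -ltnS ltn_neqAle ui hoch_le2.
Qed.

(** The nucleus lies below a lower cover that is 0 at the last 1 of [u], a position [k <= i]. By
    (T3) it has no 1 from [k] on, and it never has a 2. *)
Lemma nucleus_run u (i j : 'I_m.+1) : i \in run u -> (i <= j)%N -> nucleus u j = 0 :> nat.
Proof.
move=> /runP[nz no] ij; have [k [uk lastk]] := exists_last_one (nz ord0 (leq0n _)).
have ki : (k <= i)%N by rewrite leqNgt; apply/negP => /no; rewrite uk.
have [v /nucleus_covers/hoch_leP/(_ k) nv vk] := covers_last_one uk lastk.
move: nv; rewrite vk leqn0 => /eqP/(hoch_zero (leq_trans ki ij)).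
by have := nucleus_le1 u j; case: (nucleus u j : nat) => [|[]].
Qed.

(** Suppose a lower cover [w] of [u] has a 0 at some [k <= i]. By (T3) it has no 1 from [j] on, so
    it lies below the word [f] obtained from [u] by turning these 1's into 0. Then [f < u] forces
    [w = f], but [f] agrees with [u] before [j], where [u] has no 0. *)
Lemma nucleus_ge_one u (i j : 'I_m.+1) : (i < j)%N -> u j = 1 :> nat ->
  hoch_of set0 i.+1 <= nucleus u.
Proof.
move=> ij uj.
have one_u (k : 'I_m.+1) : (k <= j)%N -> u k != 0 :> nat by apply/le_one/le_one1.
rewrite lexI; apply/andP; split.
  by apply/le_one => k ki; apply/one_u/(leq_trans ki)/ltnW.
apply/meetsP => w /andP[wu /forallP cwu]; apply/le_one => k ki.
have kj := leq_ltn_trans ki ij.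
apply/negP => /eqP wk; have w1 (l : 'I_m.+1) : (j <= l)%N -> w l != 1 :> nat.
  by move=> jl; apply: hoch_zero wk; apply: leq_trans jl; apply: ltnW.
pose f := [ffun l : 'I_m.+1 => if (j <= l)%N && (u l == 1 :> nat) then ord0 else u l]
  : {ffun 'I_m.+1 -> 'I_3}.
have fE l : f l = (if (j <= l)%N && (u l == 1 :> nat) then 0 else u l)%N :> nat.
  by rewrite ffunE; case: ifP.
have tf : is_triword f.
  apply/triwordP; split=> [l l0|l l' ll']; rewrite !fE.
    by case: ifP => // _; apply: (hochP u).1.
  case: ifP => [/andP[jl _] _|_ ul].
    rewrite (leq_trans jl (ltnW ll')) /=; by case: eqP.
  by case: ifP => // _; apply: (hochP u).2 ul.
have wf : w <= Triword tf.
  apply/hoch_leP => l /=; rewrite fE.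
  have /hoch_leP/(_ l) := ltW wu; case: ifP => // /andP[/w1 + /eqP ->].
  by case: (w l : nat) => [|[]].
have fu : Triword tf < u.
  rewrite lt_leAnge; apply/andP; split.
    by apply/hoch_leP => l /=; rewrite fE; case: ifP.
  by apply/negP => /hoch_leP/(_ j) /=; rewrite fE leqnn uj.
have := cwu (Triword tf); rewrite fu andbT lt_neqAle wf andbT negbK => /eqP wE.
move: wk; rewrite wE /= fE leqNgt kj /= => /eqP.
exact/negP/one_u/ltnW.
Qed.

Lemma two_core_labels u l :
  (hoch_of [set l] 0 \in core_labels u) = (l \in twos u).
Proof.
rewrite inE; apply/idP/eqP => [/core_labels_le|ul].
  by rewrite le_two => /eqP.
have [v vu vl] := covers_two ul.
apply/imsetP; exists (v, u); last by rewrite /= (@label_two _ _ l) // neq_ltn vl.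
by rewrite inE /= vu lexx nucleus_covers.
Qed.

Lemma one_core_labels u (i : 'I_m.+1) :
  (hoch_of set0 i.+1 \in core_labels u) = (i \in run u).
Proof.
apply/idP/idP => [iu|iu].
  apply/runP; split; first exact/le_one/core_labels_le.
  move=> j ij; apply/negP => /eqP uj.
  case/imsetP: iu => -[v w] /[!inE] /= /and3P[nv /andP[vw _] _] lab.
  have /labelP /andP[/eqP] := ltW vw; rewrite -lab.
  (* An element below the nucleus labels no cover above it, since joining with it changes nothing
     there. *)
  have /join_l -> : hoch_of set0 i.+1 <= v by apply: le_trans (nucleus_ge_one ij uj) nv.
  by move=> vwE; rewrite vwE ltxx in vw.
(* The word 1..10..0 lies strictly above the nucleus, so one of its own lower covers [v] does too,
   weakly; the label of that cover is the word itself. *)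
have nu : nucleus u < hoch_of set0 i.+1.
  rewrite lt_leAnge; apply/andP; split; last first.
    by apply/negP => /le_one/(_ i (leqnn _)); rewrite (nucleus_run iu).
  apply/hoch_leP => j; rewrite hoch_ofE imset0 inE ltnS.
  case: (leqP j i) => ij; first exact: nucleus_le1.
  by rewrite (nucleus_run iu) // ltnW.
have [v nv vi] := lt_covers nu; have /andP[ltv _] := vi.
apply/imsetP; exists (v, hoch_of set0 i.+1).
  by rewrite inE /= nv vi; apply/le_one; case/runP: iu.
rewrite /= (@label_one _ _ i) //; last by rewrite hoch_ofE imset0 inE ltnSn.
have /existsP[j /andP[ji /eqP vj]] :
    [exists j : 'I_m.+1, (j <= i)%N && (v j == 0 :> nat)].
  apply: contraT; rewrite negb_exists => /forallP h.
  move: ltv; rewrite lt_leAnge => /andP[_ /negP[]]; apply/le_one => j ji.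
  by have := h j; rewrite ji.
have /hoch_leP/(_ i) := ltW ltv; rewrite hoch_ofE imset0 inE ltnSn.
by have := hoch_zero ji vj; case: (v i : nat) => [|[]].
Qed.

Lemma clo_hoch_leE (u v : clo (hoch m.+1)) :
  (u <= v) = (twos u \subset twos v) && (run u \subset run v).
Proof.
apply/subsetP/andP => [uv|[/subsetP uv2 /subsetP uv1] c cu].
  by split; apply/subsetP => i; rewrite -?two_core_labels -?one_core_labels; apply: uv.
have [[l cE]|[i cE]] := core_labels_cases cu; move: cu; rewrite cE.
  by rewrite !two_core_labels; apply: uv2.
by rewrite !one_core_labels; apply: uv1.
Qed.

End CoreLabelsHoch.

(** * Möbius inversion over up-sets *)

Section MobiusInversion.
Local Open Scope ring_scope.
Context {d : Order.disp_t} {P : finPOrderType d}.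
Implicit Types u v w : P.

Lemma mobius_sum_le u t : \sum_(v | (v <= t)%O) mobius u v = (u == t)%:R.
Proof.
rewrite (bigID (fun v => u <= v)%O) /= [X in _ + X]big1 ?addr0; last first.
  move=> v /andP[_ nuv]; rewrite mobiusE; case: eqP => [uv|_].
    by rewrite uv lexx in nuv.
  by case: ifP => // /ltW; rewrite (negbTE nuv).
case: (boolP (u <= t)%O) => [ut|nut]; last first.
  rewrite big1 => [|v /andP[vt uv]]; first by case: eqP nut => // ->; rewrite lexx.
  by rewrite (le_trans uv vt) in nut.
rewrite (bigD1 t) ?lexx //= mobiusE.
under eq_bigl => v do rewrite andbAC [(_ <= t)%O && _]andbC -lt_neqAle andbC.
case: eqP => [->|/eqP nut'].
  by rewrite big1 ?addr0 // => v /andP[/le_lt_trans h /h]; rewrite ltxx.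
by rewrite lt_neqAle nut' ut addNr.
Qed.

Lemma mobius_inversion (R : comPzRingType) (f g : P -> R) :
  (forall u, \sum_(v | (u <= v)%O) g v = f u) ->
  forall u, \sum_v (mobius u v)%:~R * f v = g u.
Proof.
move=> fE u; transitivity (\sum_t \sum_(v | (v <= t)%O) (mobius u v)%:~R * g t).
  rewrite (exchange_big_dep xpredT) //=; apply: eq_bigr => v _.
  by rewrite -fE mulr_sumr.
rewrite (bigD1 u) //= [X in _ + X]big1 ?addr0 => [|t tu].
  by rewrite -mulr_suml -(rmorph_sum intr) mobius_sum_le eqxx mul1r.
by rewrite -mulr_suml -(rmorph_sum intr) mobius_sum_le eq_sym (negbTE tu) mul0r.
Qed.

End MobiusInversion.

(** * Binomial sums over subsets *)

Section SetSums.
Local Open Scope ring_scope.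
Variables (R : comPzRingType) (m : nat).
Implicit Types (a b : R) (B D : {set 'I_m}).

Lemma card_setC_ord D : #|~: D| = (m - #|D|)%N.
Proof. by rewrite cardsCs setCK card_ord. Qed.

Lemma prod_set_if D a b :
  \prod_i (if i \in D then a else b) = a ^+ #|D| * b ^+ (m - #|D|).
Proof.
rewrite (bigID (mem D)) /=; congr (_ * _).
  by rewrite -prodr_const; apply: eq_bigr => i ->.
rewrite -card_setC_ord.
under eq_bigr => i /negbTE -> do [].
by rewrite -prodr_const; apply: eq_bigl => i; rewrite inE.
Qed.

Lemma sum_set_expr a b :
  \sum_(D : {set 'I_m}) a ^+ #|D| * b ^+ (m - #|D|) = (a + b) ^+ m.
Proof.
under eq_bigr => D _ do rewrite -prod_set_if.
by rewrite -bigA_distr /= prodr_const card_ord.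
Qed.

(** Expand the product with factor [a + 0] at each [i] in [B] and [a + (1 - a)] elsewhere: a set [D]
    not containing [B] picks up a 0. *)
Lemma sum_superset_expr B a :
  \sum_(D : {set 'I_m} | B \subset D) a ^+ #|D| * (1 - a) ^+ (m - #|D|) = a ^+ #|B|.
Proof.
transitivity (\prod_i (a + (if i \in B then 0 else 1 - a))); last first.
  under eq_bigr => i _.
    rewrite (_ : a + _ = if i \in B then a else 1); last first.
      by case: ifP => _; rewrite ?addr0 // addrCA subrr addr0.
    over.
  by rewrite prod_set_if expr1n mulr1.
rewrite bigA_distr [RHS](bigID (fun D => B \subset D)) /= [X in _ = _ + X]big1 ?addr0.
  apply: eq_bigr => D /subsetP BD; rewrite -prod_set_if; apply: eq_bigr => i _.
  by case: ifP => // /negbT iD; rewrite ifN //; apply: contra iD => /BD.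
move=> D /subsetPn[i iB iD].
by rewrite (bigD1 i) //= (negbTE iD) iB mul0r.
Qed.

(** Double counting: [m - #|D|] is the number of [i] outside [D], and for fixed [i] the sets
    avoiding [i] come from expanding the product with factor [b] at [i] and [a + b] elsewhere. *)
Lemma sum_set_expr_card a b :
  \sum_(D : {set 'I_m}) a ^+ #|D| * b ^+ (m - #|D|) *+ (m - #|D|) =
  (b * (a + b) ^+ m.-1) *+ m.
Proof.
transitivity (\sum_(D : {set 'I_m}) \sum_(i | i \notin D) a ^+ #|D| * b ^+ (m - #|D|)).
  apply: eq_bigr => D _; rewrite sumr_const; congr (_ *+ _).
  by rewrite -card_setC_ord; apply: eq_card => i; rewrite !inE.
rewrite (exchange_big_dep xpredT) //=.
rewrite -[X in _ *+ X]card_ord -sumr_const; apply: eq_bigr => i _.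
transitivity (\prod_j ((if j == i then 0 else a) + b)); last first.
  rewrite (bigD1 i) //= eqxx add0r; congr (_ * _).
  under eq_bigr => j /negbTE -> do [].
  by rewrite prodr_const cardC1 card_ord.
rewrite bigA_distr [RHS](bigID (fun D => i \notin D)) /= [X in _ = _ + X]big1 ?addr0.
  apply: eq_bigr => D iD; rewrite -prod_set_if; apply: eq_bigr => j _.
  by case: ifP => // jD; case: eqP => // ji; rewrite -ji jD in iD.
by move=> D /negPn iD; rewrite (bigD1 i) //= iD eqxx mul0r.
Qed.

End SetSums.

(** * The core label order on triwords and its rank function *)

Section CoreLabelOrderHoch.
Variable m : nat.
Implicit Types (u v w : hoch m.+1) (B D : {set 'I_m}) (k : nat).

Lemma twos_hoch_of D k : twos (hoch_of D k) = D.
Proof.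
apply/setP => l; rewrite inE hoch_ofE mem_imset; last exact: lift_inj.
by case: (l \in D) => //; case: ifP.
Qed.

Lemma hoch_of0 D k : hoch_of D k ord0 = (0 < k)%N :> nat.
Proof.
rewrite hoch_ofE; case: imsetP => [[l _ /eqP]|_]; last by case: ifP.
by rewrite (negbTE (neq_lift _ _)).
Qed.

(** Away from the 2's, an entry up to [i] is nonzero, hence 1, and an entry beyond [i] is not 1,
    hence 0. *)
Lemma hoch_of_run u (i : 'I_m.+1) : i \in run u -> u = hoch_of (twos u) i.+1.
Proof.
move=> /runP[nz no]; apply: hoch_inj => j; rewrite hoch_ofE mem_lift_twos ltnS.
case: eqP => [//|/eqP uj2]; have := hoch_le2 u j; move: uj2.
by case: (leqP j i) => [/nz|/no]; case: (u j : nat) => [|[|[]]].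
Qed.

Lemma hoch_of_zero u : u ord0 = 0 :> nat -> u = hoch_of (twos u) 0.
Proof.
move=> u0; apply: hoch_inj => j; rewrite hoch_ofE mem_lift_twos.
case: eqP => [//|/eqP uj2]; have := hoch_le2 u j.
move: uj2 (@hoch_zero _ u ord0 j (leq0n _) u0).
by case: (u j : nat) => [|[|[]]].
Qed.

(** Replacing entries by 2 creates neither a 0 nor a 1, so both conditions of [runP] persist. *)
Lemma run_hoch_of B D k : B \subset D -> run (hoch_of B k) \subset run (hoch_of D k).
Proof.
move=> /(imsetS (lift ord0))/subsetP BD; apply/subsetP => i /runP[nz no].
apply/runP; split=> j; rewrite hoch_ofE => ji.
  case: ifP => // /negbT jD.
  by have := nz j ji; rewrite hoch_ofE ifN // (contra (@BD j)).
case: ifP => // /negbT jD.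
by have := no j ji; rewrite hoch_ofE ifN // (contra (@BD j)).
Qed.

Lemma exists_run u : u ord0 != 0 :> nat -> exists i, i \in run u.
Proof. by case/exists_last_one => i [ui lasti]; exists i; apply: run_last_one. Qed.

Lemma run_neq0 u i : i \in run u -> u ord0 != 0 :> nat.
Proof. by move=> /runP[nz _]; apply: nz. Qed.

Lemma clo_hoch_le_zero (u v : clo (hoch m.+1)) : u ord0 = 0 :> nat ->
  (u <= v) = (twos u \subset twos v).
Proof.
move=> u0; rewrite clo_hoch_leE (_ : run u \subset run v) ?andbT //.
by apply/subsetP => i /run_neq0; rewrite u0.
Qed.

Lemma clo_hoch_le_run (u v : clo (hoch m.+1)) (i : 'I_m.+1) : i \in run u ->
  (u <= v) = (twos u \subset twos v) && (v == hoch_of (twos v) i.+1).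
Proof.
move=> iu; rewrite clo_hoch_leE; apply: andb_id2l => uv; apply/idP/eqP.
  by move=> /subsetP/(_ i iu)/hoch_of_run.
by move=> ->; rewrite {1}(hoch_of_run iu); apply: run_hoch_of.
Qed.

Definition clo_rank (u : hoch m.+1) : nat := #|twos u| + u ord0.

(* Strictly above [u], either some element has one more 2 or, when [u] and [v]
   have the same 2's, the only change is that the empty run became nonempty. *)
Lemma clo_rank_step (u v : clo (hoch m.+1)) : u < v ->
  exists w : clo (hoch m.+1), [/\ u < w, w <= v & clo_rank w = (clo_rank u).+1].
Proof.
move=> uv; have := ltW uv; rewrite clo_hoch_leE => /andP[twuv ruv].
have add_two k l : l \notin twos u -> u = hoch_of (twos u) k ->
    let w := hoch_of (l |: twos u) k : clo (hoch m.+1) in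
    u < w /\ clo_rank w = (clo_rank u).+1.
  move=> lu uk w; have ww : twos w = l |: twos u by apply: twos_hoch_of.
  split; last first.
    rewrite /clo_rank ww cardsU1 lu add1n addSn; congr (_ + _).+1%N.
    by rewrite [in RHS]uk !hoch_of0.
  rewrite lt_neqAle; apply/andP; split.
    by apply: contraNneq lu => ->; rewrite ww setU11.
  rewrite clo_hoch_leE ww subsetUr /= {1}uk; apply: run_hoch_of; exact: subsetUr.
have [vu|] := boolP (twos v \subset twos u); last first.
  case/subsetPn => l lv lu.
  have luv : l |: twos u \subset twos v by rewrite subUset sub1set lv.
  have [u0|/exists_run[i iu]] := eqVneq (u ord0 : nat) 0%N.
    have [uw rw] := add_two _ _ lu (hoch_of_zero u0); exists (hoch_of (l |: twos u) 0).
    by split=> //; rewrite clo_hoch_le_zero ?hoch_of0 // twos_hoch_of.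
  have [uw rw] := add_two _ _ lu (hoch_of_run iu); exists (hoch_of (l |: twos u) i.+1).
  split=> //; rewrite clo_hoch_leE twos_hoch_of luv /=.
  rewrite (hoch_of_run (subsetP ruv i iu)); exact: run_hoch_of.
have tuv : twos u = twos v by apply/eqP; rewrite eqEsubset twuv.
exists v; split=> //; rewrite /clo_rank tuv -addnS; congr (_ + _)%N.
have neq : u <> v by move=> e; rewrite e ltxx in uv.
have u0 : u ord0 = 0 :> nat.
  apply/eqP; apply: contraT => /exists_run[i iu]; case: neq.
  by rewrite (hoch_of_run iu) (hoch_of_run (subsetP ruv i iu)) tuv.
have : v ord0 != 0 :> nat.
  by apply/eqP => v0; case: neq; rewrite (hoch_of_zero u0) (hoch_of_zero v0) tuv.
by rewrite u0; have := hoch0 v; case: (v ord0 : nat) => [|[]].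
Qed.

Lemma rank_clo_hoch (u : clo (hoch m.+1)) : rank u = clo_rank u.
Proof.
apply/esym; apply: (rank_unique (bot := (\bot : hoch m.+1) : clo (hoch m.+1))).
- exact: clo_bot_le.
- rewrite /clo_rank (_ : twos _ = set0) ?cards0 ?ffunE //.
  by apply/setP => l; rewrite !inE ffunE.
move=> {}u v /andP[/clo_rank_step[w [uw wv <-]] /forallP/(_ w)].
by rewrite uw lt_neqAle wv andbT negbK => /eqP ->.
Qed.

Section Sums.
Local Open Scope ring_scope.
Variable R : nmodType.

(* The triwords with a given set of 2's: one starts with 0, and the others are
   determined by the position of their last 1. *)
Lemma sum_twos D (a b : R) :
  \sum_(u : hoch m.+1 | twos u == D) (if u ord0 == 0 :> nat then a else b) =
  a + b *+ (m.+1 - #|D|).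
Proof.
rewrite (bigID (fun u : hoch m.+1 => u ord0 == 0 :> nat)) /=; congr (_ + _).
  rewrite (big_pred1 (hoch_of D 0)) ?hoch_of0 // => u.
  apply/andP/eqP => [[/eqP <- /eqP]|->]; first exact: hoch_of_zero.
  by rewrite twos_hoch_of hoch_of0 !eqxx.
under eq_bigr => u /andP[_ /negbTE ->] do [].
rewrite sumr_const; congr (_ *+ _).
(* The possible positions of the last 1, in bijection with the words counted. *)
pose lasts := ~: (lift ord0 @: D).
have hoch_ofk (i j : 'I_m.+1) : j \in lasts -> hoch_of D i.+1 j = (j <= i)%N :> nat.
  by rewrite inE hoch_ofE => /negbTE ->; rewrite ltnS; case: ifP.
transitivity #|[set hoch_of D (i : 'I_m.+1).+1 | i in lasts]|; last first.
  rewrite card_in_imset; last first.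
    move=> i j il jl ij; apply/val_inj/eqP => /=.
    have eq_ij l : hoch_of D i.+1 l = hoch_of D j.+1 l :> nat by rewrite ij.
    have := eq_ij j; have := eq_ij i; rewrite !hoch_ofk // !leqnn eqn_leq.
    by do 2 case: (_ <= _)%N.
  rewrite /lasts cardsCs setCK card_ord card_imset //; exact: lift_inj.
apply: eq_card => u; rewrite [LHS]unfold_in /=.
apply/andP/imsetP => [[/eqP twu]|[i il ->]].
  case/exists_last_one => i [ui lasti]; exists i.
    by rewrite /lasts -twu inE mem_lift_twos ui.
  by rewrite -twu; apply/hoch_of_run/run_last_one.
by rewrite twos_hoch_of hoch_of0.
Qed.

End Sums.

(** * Evaluation of the M-triangle *)

Section Triangle.
Local Open Scope ring_scope.
Variable K : fieldType.
Implicit Types x y : K.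

(** The last factor is chosen so that, over all words with a given set of 2's, it sums to 1: one
    word starts with 0 and [m.+1 - #|twos u|] words start with 1. *)
Definition mobius_weight y (u : hoch m.+1) : K :=
  y ^+ #|twos u| * (1 - y) ^+ (m - #|twos u|) *
  (if u ord0 == 0 :> nat then 1 - y *+ (m.+1 - #|twos u|) else y).

(** For each [D] containing [twos u], the last factors of the weights sum to 1 if [u] starts with 0,
    as all words with 2's at [D] lie above [u], and to [y] otherwise, as only one does. The sum over
    [D] is then [sum_superset_expr]. *)
Lemma sum_mobius_weight y (u : clo (hoch m.+1)) :
  \sum_(v : clo (hoch m.+1) | (u <= v)%O) mobius_weight y v = y ^+ rank u.
Proof.
rewrite (partition_big (@twos m) (fun D => twos u \subset D)) /=; last first.
  by move=> v; rewrite clo_hoch_leE => /andP[].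
rewrite rank_clo_hoch /clo_rank exprD -sum_superset_expr mulr_suml.
apply: eq_bigr => D uD.
transitivity (y ^+ #|D| * (1 - y) ^+ (m - #|D|) *
    \sum_(v : clo (hoch m.+1) | (u <= v)%O && (twos v == D))
    (if v ord0 == 0 :> nat then 1 - y *+ (m.+1 - #|D|) else y)).
  by rewrite mulr_sumr; apply: eq_bigr => v /andP[_ /eqP <-].
congr (_ * _).
have [u0|u0] := eqVneq (u ord0 : nat) 0%N.
  rewrite u0 expr0 -[RHS](subrK (y *+ (m.+1 - #|D|))) -sum_twos.
  by apply: eq_bigl => v; rewrite clo_hoch_le_zero // andbC; case: eqP => // ->.
have [i iu] := exists_run u0.
rewrite (big_pred1 (hoch_of D i.+1 : clo (hoch m.+1))) => [|v].
  rewrite hoch_of0 /=; have := hoch0 u.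
  by case: (u ord0 : nat) u0 => [|[]] //= _ _; rewrite expr1.
rewrite (clo_hoch_le_run _ iu); apply/andP/eqP => [[/andP[_ /eqP vE] /eqP <-]|->] //.
by rewrite twos_hoch_of uD !eqxx.
Qed.

Lemma M_triangleE x y : M_triangle m.+1 x y =
  (1 - y + x * y) ^+ m.+1 +
  ((x - 1) * y * (1 - y) * (1 - y + x * y) ^+ m.-1) *+ m.
Proof.
set s := 1 - y + x * y.
transitivity (\sum_(u : hoch m.+1) x ^+ clo_rank u * mobius_weight y u).
  apply: eq_bigr => u _; rewrite -rank_clo_hoch -(mobius_inversion (sum_mobius_weight y)).
  by rewrite mulr_sumr; apply: eq_bigr => v _; rewrite mulrA [x ^+ _ * _]mulrC.
rewrite (partition_big (@twos m) xpredT) //=.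
(* The words with 2's at [D] contribute the factor [1 + (x - 1) * y * (m + 1 - #|D|)]; writing the
   count as [1 + (m - #|D|)] matches the two subset sums. *)
transitivity (\sum_(D : {set 'I_m}) ((1 + (x - 1) * y) *
    ((x * y) ^+ #|D| * (1 - y) ^+ (m - #|D|)) +
    (x - 1) * y * ((x * y) ^+ #|D| * (1 - y) ^+ (m - #|D|) *+ (m - #|D|)))).
  apply: eq_bigr => D _.
  transitivity ((x * y) ^+ #|D| * (1 - y) ^+ (m - #|D|) *
      \sum_(u : hoch m.+1 | twos u == D)
      (if u ord0 == 0 :> nat then 1 - y *+ (m.+1 - #|D|) else x * y)).
    rewrite mulr_sumr; apply: eq_bigr => u /eqP uD.
    rewrite /mobius_weight /clo_rank uD exprMn exprD.
    have := hoch0 u; case: (u ord0 : nat) => [|[]] //= _; ring.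
  rewrite sum_twos subSn; last by rewrite -[X in (_ <= X)%N]card_ord max_card.
  rewrite !mulrS -[y *+ _]mulr_natr -[(x * y) *+ _]mulr_natr.
  rewrite -[(_ ^+ _ * _) *+ _]mulr_natr; ring.
rewrite big_split /= -!mulr_sumr sum_set_expr sum_set_expr_card.
have -> : x * y + (1 - y) = s by rewrite addrC.
rewrite exprS mulrnAr; congr (_ * _ + _ *+ _); first by rewrite /s; ring.
by rewrite !mulrA.
Qed.

End Triangle.
End CoreLabelOrderHoch.

(** * Substitution into the M-triangle *)

Section ClosedForms.
Local Open Scope ring_scope.
Variable K : fieldType.
Implicit Types p q x y : K.

(* Both triangles are this expression: [p / q] is the value of [1 - y + x * y]
   after substitution, and the factor [q ^+ m.+1] clears the denominators. *)
Lemma homogenized_closed_form m p q c e : p != 0 -> q != 0 -> c * q ^+ 2 = e ->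
  q ^+ m.+1 * ((p / q) ^+ m.+1 + (c * (p / q) ^+ m.-1) *+ m) =
  p ^ (m.+1%:Z - 2) * (p ^+ 2 + e *+ m).
Proof.
move=> p0 q0 <-.
have -> : p ^ (m.+1%:Z - 2) = p ^+ m.+1 / p ^+ 2.
  by rewrite expfzDr // -exprnP exprnN.
(* For [m = 0] the exponent [m.-1] is truncated and [p] has exponent -1, but the terms multiplied by
   [m] vanish. *)
rewrite -[(c * _) *+ m]mulr_natr -[(c * _ ^+ 2) *+ m]mulr_natr; case: m => [|m] /=.
  by rewrite !mulr0 !addr0 !expr1; field; rewrite p0.
rewrite !expr_div_n !exprS; field.
by rewrite p0 q0 ?expf_neq0.
Qed.

Lemma F_triangleE m x y : y != 0 -> y - x != 0 -> x + y + 1 != 0 ->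
  F_triangle m.+1 x y = (x + y + 1) ^ (m.+1%:Z - 2) *
    (m.+1%:R * x ^+ 2 + 2 * x * y + (m.+1%:R + 1) * x + (y + 1) ^+ 2).
Proof.
move=> y0 yx s0; rewrite /F_triangle M_triangleE.
have -> : 1 - (y - x) / y + (y + 1) / (y - x) * ((y - x) / y) = (x + y + 1) / y.
  by field; rewrite y0.
(* After substitution [(x - 1) * y] becomes [(x + 1) / y] and [1 - y] becomes [x / y]; clearing
   [y ^+ 2] leaves [x * (x + 1)]. *)
rewrite (@homogenized_closed_form _ _ _ _ (x * (x + 1))) //.
  by congr (_ * _); rewrite -(mulr_natr _ m) -natr1; ring.
by field; rewrite y0.
Qed.

Lemma H_triangleE m x y : y - 1 != 0 -> x * (y - 1) + 1 != 0 -> x * y + 1 != 0 ->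
  H_triangle m.+1 x y =
    (x * y + 1) ^ (m.+1%:Z - 2) * ((x * y + 1) ^+ 2 + (m.+1%:R - 1) * x).
Proof.
move=> y1 q0 s0; rewrite /H_triangle M_triangleE.
set q := x * (y - 1) + 1 in q0 *.
have -> : 1 - x * (y - 1) / q + y / (y - 1) * (x * (y - 1) / q) = (x * y + 1) / q.
  by rewrite /q in q0 *; field; rewrite y1 q0.
(* Here [(x - 1) * y] becomes [x / q] and [1 - y] becomes [1 / q], which leaves [x]. *)
rewrite (@homogenized_closed_form _ _ _ _ x) //.
  by congr (_ * _); rewrite -(mulr_natr _ m) -natr1; ring.
by rewrite /q in q0 *; field; rewrite y1 q0.
Qed.

End ClosedForms.

(** * Specialisation to the field of rational functions *)

Local Open Scope ring_scope.

(** Reduces the nonvanishing of denominators to a numerical evaluation at one point. *)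
Lemma tofrac_neq0 (n : nat) (R : idomainType) (v : 'I_n -> R) (p : {mpoly R[n]}) :
  meval v p != 0 -> tofrac p != 0.
Proof. by apply: contraNneq => /eqP; rewrite tofrac_eq0 => /eqP ->; rewrite meval0. Qed.

Theorem corollary6p7 (n : nat) (n_gt0 : (0 < n)%N) :
  let x : ratfun2 := ratX in
  let y : ratfun2 := ratY in
  F_triangle n x y =
    (x + y + 1) ^ (n%:Z - 2) *
    (n%:R * x ^+ 2 + 2 * x * y + (n%:R + 1) * x + (y + 1) ^+ 2) /\
  H_triangle n x y =
    (x * y + 1) ^ (n%:Z - 2) * ((x * y + 1) ^+ 2 + (n%:R - 1) * x).
Proof.
case: n n_gt0 => // m _ /=.
(* None of the denominators vanishes at (x, y) = (1, 2). *)
pose v (i : 'I_2) : rat := if i == ord0 then 1 else 2.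
have vx : meval v 'X_(@ord0 1) = 1 by rewrite mevalXU.
have vy : meval v 'X_(@ord_max 1) = 2 by rewrite mevalXU.
rewrite F_triangleE ?H_triangleE // /ratX /ratY -?tofrac1 -?(tofracM, tofracB, tofracD);
  by apply: (@tofrac_neq0 _ _ v); rewrite ?(mevalB, mevalD, mevalM, meval1, vx, vy).
Qed.
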